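(* Let $S$ be a simple Hausdorff topological semigroup. If $S$ is doubly countably compact and the square $S\times S$ is countably compact, then $S$ is a topological paragroup.
   Context: All topological spaces are Hausdorff and all semigroups are nonempty. A topological semigroup is a topological space with a jointly continuous associative binary operation. A semigroup $S$ is simple if it contains no proper (nonempty) two-sided ideal. A space is countably compact if each of its closed discrete subspaces is finite. Let $\omega=\{0,1,2,\dots\}$. For a free (non-principal) ultrafilter $p$ on $\omega$, a point $x_\infty\in X$ is the $p$-limit $\lim_{n\to p}x_n$ of a sequence $(x_n)$ in a space $X$, indexed by a set $P\in p$, if for each neighborhood $O$ of $x_\infty$ the set $\{n\in P:x_n\in O\}$ belongs to $p$. A double sequence $(x_{m,n})_{m,n\in\omega}$ in $X$ has a double $p$-limit $\lim_{n\to p}\lim_{m\to p}x_{m,n}$ if the set $P=\{n\in\omega: \lim_{m\to p}x_{m,n}\text{ exists in }X\}$ belongs to $p$ and the sequence $(\lim_{m\to p}x_{m,n})_{n\in P}$ has a $p$-limit in $X$. A space $X$ is doubly countably compact if each double sequence $(x_{m,n})_{m,n\in\omega}$ in $X$ has a double $p$-limit in $X$ for some free ultrafilter $p$ on $\omega$ (depending on the double sequence). For a group $H$, sets $X,Y$ and a map $\sigma:Y\times X\to H$, the Rees product $[X,H,Y]_\sigma$ is the set $X\times H\times Y$ with the operation $(x,h,y)\cdot(x',h',y')=(x,h\,\sigma(y,x')\,h',y')$. A topological paragroup is a topological semigroup that is topologically isomorphic (isomorphic via a homeomorphism) to a Rees product $[X,H,Y]_\sigma$ with the product topology, where $X,Y$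 are topological spaces, $H$ is a topological group (multiplication and inversion continuous) and $\sigma:Y\times X\to H$ is continuous. *)

(* Defs.v *)
From HB Require Import structures.
From mathcomp Require Import all_boot all_classical.
From mathcomp Require Import topology.

Set Implicit Arguments.
Unset Strict Implicit.
Unset Printing Implicit Defensive.

Local Open Scope classical_set_scope.

HB.structure Definition PreTopologicalSemigroup :=
  {S of Topological S & Semigroup S}.

HB.mixin Record PreTopologicalSemigroup_isTopologicalSemigroup S
    & PreTopologicalSemigroup S := {
  mulg_continuous : continuous (fun xy : S * S => (xy.1 * xy.2)%g)
}.

#[short(type="topologicalSemigroupType")]
HB.structure Definition TopologicalSemigroup :=
  {S of PreTopologicalSemigroup S
      & PreTopologicalSemigroup_isTopologicalSemigroup S}.

HB.mixin Record TopologicalSemigroup_isTopologicalGroup H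
    & TopologicalSemigroup H & Group H := {
  invg_continuous : continuous (fun x : H => (x^-1)%g)
}.

#[short(type="topologicalGroupType")]
HB.structure Definition TopologicalGroup :=
  {H of TopologicalSemigroup H & Group H
      & TopologicalSemigroup_isTopologicalGroup H}.

Definition two_sided_ideal (S : semigroupType) (I : set S) : Prop :=
  I !=set0 /\ forall s x : S, I x -> I (s * x)%g /\ I (x * s)%g.

Definition simple_semigroup (S : semigroupType) : Prop :=
  forall I : set S, two_sided_ideal I -> I = [set: S].

(* The points of [D] are those of the type [set_type D], which carries the
   subspace topology. *)
Definition discrete_subspace (X : topologicalType) (D : set X) : Prop :=
  forall x : set_type D, open [set x].

Definition countably_compact (X : topologicalType) : Prop :=
  forall D : set X, closed D -> discrete_subspace D -> finite_set D.

Definition free_ultrafilter (p : set_system nat) : Prop :=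
  UltraFilter p /\ forall n : nat, p <> principal_filter n.

(* Only the values of [x] on the index set [P] matter. *)
Definition is_plim (X : topologicalType) (p : set_system nat) (P : set nat)
    (x : nat -> X) (l : X) : Prop :=
  forall O : set X, nbhs l O -> p [set n | P n /\ O (x n)].

(* In a Hausdorff space, [y] is uniquely determined on [P]. *)
Definition has_double_plim (X : topologicalType) (p : set_system nat)
    (x : nat -> nat -> X) : Prop :=
  let P := [set n | exists l : X, is_plim p [set: nat] (fun m => x m n) l] in
  p P /\
  exists y : nat -> X,
    (forall n, P n -> is_plim p [set: nat] (fun m => x m n) (y n)) /\
    exists l : X, is_plim p P y l.

Definition doubly_countably_compact (X : topologicalType) : Prop :=
  forall x : nat -> nat -> X,
    exists p : set_system nat, free_ultrafilter p /\ has_double_plim p x.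

(* The nested pair [(x, h, y)] is the triple [((x, h), y)]. *)
Definition rees_product (X Y : topologicalType) (H : topologicalGroupType)
    (sigma : Y * X -> H) : Type := (X * H * Y)%type.

Section ReesProduct.
Variables (X Y : topologicalType) (H : topologicalGroupType).
Variable sigma : Y * X -> H.

HB.instance Definition _ :=
  Topological.copy (rees_product sigma) (X * H * Y)%type.

Definition rees_mul (a b : rees_product sigma) : rees_product sigma :=
  let: (x, h, y) := a in
  let: (x', h', y') := b in
  (x, (h * sigma (y, x') * h')%g, y').

Lemma rees_mulA : associative rees_mul.
Proof. by move=> [[x h] y] [[x' h'] y'] [[x2 h2] y2]; rewrite /= !mulgA. Qed.

HB.instance Definition _ := isSemigroup.Build (rees_product sigma) rees_mulA.

End ReesProduct.

Definition topological_isomorphism (S T : PreTopologicalSemigroup.type)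
    (f : S -> T) : Prop :=
  {morph f : a b / (a * b)%g >-> (a * b)%g} /\
  continuous f /\
  exists g : T -> S, cancel f g /\ cancel g f /\ continuous g.

Definition topological_paragroup (S : topologicalSemigroupType) : Prop :=
  exists (X Y : topologicalType) (H : topologicalGroupType)
         (sigma : Y * X -> H),
    hausdorff_space X /\ hausdorff_space Y /\ hausdorff_space H /\
    continuous sigma /\
    exists f : S -> rees_product sigma, topological_isomorphism f.

(* Main.v *)
(* Applying double countable compactness to [a ^ (m - n)] gives, for almost all
   [n], limits [y_n] over [m] and a limit [e] of the [y_n]. Since
   [a ^ (k - n) y_k = y_n] for [n < k], letting [k] vary yields [y_n e = y_n],
   hence [e e = e].

   In the monoid [e S e], let [b c = e] and let [(x, y)] be a cluster point of
   [(b ^ n, c ^ n)]. Then [x y = e], and [c b (b ^ n y) = b ^ n y] because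
   [b ^ (n + 1) c ^ m = c ^ (m - n - 1)] for [m > n]; in the limit
   [c b x y = x y], so [c b = e]. As simplicity gives [e] in [S h S] for every
   [h] in [e S e], this makes [e S e] a group.

   Its inversion is continuous at [e]. Otherwise take neighborhoods
   [V_(n+1) V_(n+1) <= V_n] of [e] and [x_n] in [V_(n+1)] with [x_n^-1] not in
   [V_0], and put [y_n = x_0 ... x_(n-1)]. A cluster point of [(y_n, y_n^-1)]
   gives [n < m] with [y_m^-1 y_n] in [V_1], whence
   [x_n^-1 = (x_(n+1) ... x_(m-1)) (y_m^-1 y_n)] lies in [V_1 V_1 <= V_0].

   With [g_s] the inverse of [e s e] in [e S e], simplicity yields
   [s g_s s = s], and [s |-> (s g_s, e s e, g_s s)] is the isomorphism onto a
   Rees product; its inverse is [(x, h, y) |-> x h y]. *)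
Require Import Defs.
From HB Require Import structures.
From mathcomp Require Import all_boot all_classical.
From mathcomp Require Import topology.

Set Implicit Arguments.
Unset Strict Implicit.
Unset Printing Implicit Defensive.

Local Open Scope classical_set_scope.
Local Open Scope group_scope.

(** * Cluster points and countable compactness *)

Lemma cvg_near_unique (T : Type) (X : topologicalType) (F : set_system T)
    (u v : T -> X) (x y : X) :
  ProperFilter F -> hausdorff_space X -> u @ F --> x -> v @ F --> y ->
  (\forall t \near F, u t = v t) -> x = y.
Proof.
move=> PF hX ux vy uv; apply: (cvg_unique hX (F := u @ F)) => //.
by move=> U /vy; rewrite /fmap /=; apply: filterS2 uv => t /= ->.
Qed.

(** Refining [F] to a filter that converges to [x] reduces this to uniqueness of limits. It carries
    identities between the terms of a sequence over to its cluster points. *)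
Lemma cluster_eq (X T : topologicalType) (F : set_system X) (x : X)
    (f g : X -> T) :
  ProperFilter F -> hausdorff_space T -> continuous f -> continuous g ->
  cluster F x -> (\forall z \near F, f z = g z) -> f x = g x.
Proof.
move=> PF hT cf cg; rewrite cluster_cvgE => -[G PG [Gx FG]] /FG.
apply: (cvg_near_unique PG hT).
  exact: cvg_comp Gx (cf x).
exact: cvg_comp Gx (cg x).
Qed.

Lemma cluster_fmap (X Y : topologicalType) (F : set_system X) (f : X -> Y)
    (x : X) :
  continuous f -> cluster F x -> cluster (f @ F) (f x).
Proof.
move=> cf clx A B FA /cf fxB; have [z [Az Bz]] := clx _ _ FA fxB.
by exists (f z).
Qed.

(** A point adherent to [A] but outside [A] would be a cluster point of [u]: the values in [A] of
    index below [N] form a finite, hence closed, set, so every neighborhood of the point meets [A]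
    in a value of index at least [N]. *)
Lemma closed_sub_range (X : topologicalType) (u : nat -> X) (A : set X) :
  hausdorff_space X -> ~ (exists x, cluster (u @ \oo) x) ->
  A `<=` range u -> closed A.
Proof.
move=> hX ncl Au x clA; apply: contrapT => Ax; apply: ncl; exists x.
move=> B O [N _ uB] xO; apply: contrapT => BO.
pose D := u @` `I_N `&` A.
have cD : closed D.
  apply: (proj1 (accessible_finite_set_closed)).
    exact: hausdorff_accessible.
  by apply: sub_finite_set (finite_image u (finite_II N)) => z [].
have xD : nbhs x (~` D).
  by apply: open_nbhs_nbhs; split; [exact: closed_openC|move=> []].
have [z [Az [Oz Dz]]] := clA _ (filterI xO xD).
have [n _ nz] := Au _ Az; have [nN|Nn] := ltnP n N.
  by apply: Dz; split=> //; exists n.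
by apply: BO; exists z; split=> //; rewrite -nz; exact: uB.
Qed.

(** Without cluster points all subsets of [range u] are closed, so [range u] is closed and discrete,
    hence finite and compact; compactness then yields a cluster point after all. *)
Lemma countably_compact_cluster (X : topologicalType) (u : nat -> X) :
  hausdorff_space X -> countably_compact X -> exists x, cluster (u @ \oo) x.
Proof.
move=> hX ccX; apply: contrapT => ncl.
have clR A : A `<=` range u -> closed A by exact: closed_sub_range.
have /finite_compact cR : finite_set (range u).
  apply: ccX => [|x]; first exact: clR.
  have -> : [set x] = \val @^-1` (~` (range u `\ \val x)) :> set (set_type _).
    apply/seteqP; split=> [_ -> [_ /(_ erefl)]//|y yx] /=.
    apply: val_inj; apply: contrapT => nyx; apply: yx; split=> //.
    exact: set_mem (valP y).
  apply: open_comp => [? _|]; first exact: initial_continuous.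
  by apply: closed_openC; apply: clR => ? [].
have uR : (u @ \oo) (range u) by exists 0 => // n _; exists n.
by have [x [_ clx]] := cR (u @ \oo) _ uR; apply: ncl; exists x.
Qed.

(** * Continuity of products and existence of an idempotent *)

Lemma cvg_mulg (T : Type) (S : topologicalSemigroupType) (F : set_system T)
    (u v : T -> S) (x y : S) :
  Filter F -> u @ F --> x -> v @ F --> y -> (fun t => u t * v t) @ F --> x * y.
Proof.
move=> FF ux vy; exact: cvg_comp (cvg_pair ux vy) (@mulg_continuous S (x, y)).
Qed.

Lemma continuous_mulg (X : topologicalType) (S : topologicalSemigroupType)
    (f g : X -> S) :
  continuous f -> continuous g -> continuous (fun x => f x * g x).
Proof. by move=> cf cg x; apply: cvg_mulg; [exact: cf|exact: cg]. Qed.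

Lemma continuous_lmul (S : topologicalSemigroupType) (z : S) :
  continuous (fun x => z * x).
Proof. by apply: continuous_mulg => x; [exact: cvg_cst|exact: cvg_id]. Qed.

Lemma continuous_rmul (S : topologicalSemigroupType) (z : S) :
  continuous (fun x => x * z).
Proof. by apply: continuous_mulg => x; [exact: cvg_id|exact: cvg_cst]. Qed.

Lemma free_ultrafilter_cofinite (p : set_system nat) (n : nat) :
  free_ultrafilter p -> \forall m \near p, n < m.
Proof.
move=> [Up fp]; have PF : ProperFilter p := @ultra_proper _ _ Up.
(* If [p] contained [[set k]], it would contain the principal ultrafilter at [k], and equal it by
   maximality. *)
have pC k : p (~` [set k]).
  have [pk|//] := in_ultra_setVsetC [set k] Up.
  case: (fp k); have Uk := principal_filter_ultra k.
  apply: (@max_filter _ _ Uk) => U /principal_filterP Ux.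
  by apply: filterS pk => _ ->.
elim: n => [|n IH]; first by apply: filterS (pC 0) => -[/(_ erefl)|].
apply: filterS2 IH (pC n.+1) => m nm mn /=.
by rewrite ltn_neqAle nm andbT; apply/eqP => /esym.
Qed.

(* [a ^ n] for [n > 0]; for lack of a unit, [apow a 0] is [a]. *)
Definition apow (S : semigroupType) (a : S) (n : nat) := iter n.-1 (mul a) a.

Lemma apowD (S : semigroupType) (a : S) (m n : nat) :
  0 < m -> 0 < n -> apow a (m + n) = apow a m * apow a n.
Proof.
case: m n => [//|m] [//|n] _ _; rewrite /apow addSn addnS /=.
by elim: m => //= m IH; rewrite IH mulgA.
Qed.

Lemma idempotent_exists (S : topologicalSemigroupType) :
  [set: S] !=set0 -> hausdorff_space S -> doubly_countably_compact S ->
  exists e : S, e * e = e.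
Proof.
move=> [a _] hS /(_ (fun m n => apow a (m - n))) [p [fp [pP [y [yP [e ye]]]]]].
have Up : UltraFilter p by case: fp.
have PF : ProperFilter p := @ultra_proper _ _ Up.
have cvgP (P : set nat) (u : nat -> S) (l : S) : is_plim p P u l -> u @ p --> l.
  move=> ul O lO; suff: p (u @^-1` O) by [].
  by apply: filterS (ul O lO) => n [].
have {}yP n := fun Pn => cvgP _ _ _ (yP n Pn); have {}ye := cvgP _ _ _ ye.
set P := (X in p X) in pP yP.
have shift n k : P n -> P k -> n < k -> apow a (k - n) * y k = y n.
  move=> Pn Pk nk.
  apply: (cvg_near_unique PF hS
    (cvg_mulg _ (cvg_cst (apow a (k - n))) (yP _ Pk)) (yP _ Pn)).
  (* For [m > k] no difference is truncated and no exponent is 0, so the powers add up; [p] contains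
     the set of these [m]. *)
  apply: filterS (free_ultrafilter_cofinite k fp) => m km.
  by rewrite -apowD ?subn_gt0// addnC addnBA ?(ltnW nk)// subnK// ltnW.
have ye_y n : P n -> y n * e = y n.
  move=> Pn.
  (* The index [k] now moves in both factors: [apow a (k - n)] tends to [y n] and [y k] tends to
     [e], while by [shift] their product stays at [y n]. *)
  apply: (cvg_near_unique PF hS (cvg_mulg _ (yP _ Pn) ye) (cvg_cst _)).
  apply: filterS2 pP (free_ultrafilter_cofinite n fp) => k; exact: shift.
exists e; apply: (cvg_near_unique PF hS (cvg_mulg _ ye (cvg_cst e)) ye).
exact: filterS pP.
Qed.

(** * Separation in products, and one-sided inverses *)

Lemma hausdorff_separating (X : topologicalType) :
  (forall p q : X, p <> q -> exists (Y : topologicalType) (f : X -> Y),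
    [/\ hausdorff_space Y, continuous f & f p <> f q]) ->
  hausdorff_space X.
Proof.
(* Continuous maps send inseparable points to inseparable points. *)
move=> sepX p q clpq; apply: contrapT => /sepX[Y [f [hY cf]]]; apply.
by apply: hY; apply: cvg_cluster (cluster_fmap cf clpq); exact: cf.
Qed.

Lemma hausdorff_prod (X Y : topologicalType) :
  hausdorff_space X -> hausdorff_space Y -> hausdorff_space (X * Y)%type.
Proof.
move=> hX hY; apply: hausdorff_separating => -[p1 p2] [q1 q2] npq.
have [pq1|npq1] := pselect (p1 = q1).
  exists Y, snd; split=> //; first by move=> ?; exact: cvg_snd.
  by move=> /= pq2; apply: npq; rewrite pq1 pq2.
by exists X, fst; split=> // ?; exact: cvg_fst.
Qed.

(** The form in which countable compactness of the square is used; it passes from [S] to [e S e]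
    along the retraction [s |-> e s e]. *)
Definition pair_cluster (X : topologicalType) :=
  forall u v : nat -> X, exists x y : X,
    cluster ((fun n => (u n, v n)) @ \oo) (x, y).

Lemma right_inverse_left (S : topologicalSemigroupType) (e b c : S) :
  hausdorff_space S -> pair_cluster S ->
  e * b = b -> b * e = b -> e * c = c -> c * e = c -> b * c = e -> c * b = e.
Proof.
move=> hS clS eb be ec ce bc; have ee : e * e = e by rewrite -{2}bc mulgA eb.
pose B n := iter n (mul b) e; pose C n := iter n (mul c) e.
have eB n : e * B n = B n by case: n => [|n] //=; rewrite mulgA eb.
have Be n : B n * e = B n by elim: n => //= n IH; rewrite -mulgA IH.
have Ce n : C n * e = C n by elim: n => //= n IH; rewrite -mulgA IH.
have eC n : e * C n = C n by case: n => [|n] //=; rewrite mulgA ec.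
have BS n : B n.+1 = B n * b.
  by elim: n => [|n IH] /=; [rewrite be eb|rewrite -mulgA -IH].
have CD m n : C (m + n) = C m * C n.
  by elim: m => [|m IH]; rewrite ?add0n ?eC// addSn /= IH mulgA.
have CS n : C n.+1 = C n * c by rewrite -addn1 CD /= ce.
have BC n : B n * C n = e.
  by elim: n => [|n IH] //; rewrite BS /= -mulgA [b * _]mulgA bc eC.
have BSl n : B n.+1 = b * B n by [].
clearbody B C.
have [x [y clxy]] := clS B C.
have c1 : continuous (fst : S * S -> S) by move=> ?; exact: cvg_fst.
have c2 : continuous (snd : S * S -> S) by move=> ?; exact: cvg_snd.
have cc (z : S) : continuous (fun _ : S * S => z) by move=> ?; exact: cvg_cst.
have xy : x * y = e.
  apply: (cluster_eq _ hS (continuous_mulg c1 c2) (cc e) clxy).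
  by exists 0 => // n _; exact: BC.
have Dy n : c * B n.+1 * y = B n * y.
  apply: (cluster_eq _ hS (continuous_mulg (cc (c * B n.+1)) c2)
    (continuous_mulg (cc (B n)) c2) clxy).
  (* Splitting [n.+1] factors [c] off [C m] reduces both sides to [c * C (m - n.+1)]. *)
  exists n.+1 => // m /= nm; rewrite -(subnKC nm) CD !mulgA.
  by rewrite -[c * _ * _]mulgA BC ce CS [B n * _]mulgA BC ec.
have -> : c * b = c * b * x * y by rewrite -mulgA xy -mulgA be.
rewrite -[RHS]xy.
(* Here [y] stays fixed and only [B n] varies: [Dy] reads [c * b * B n * y = B n * y], and [x] is
   the cluster point of [B]. *)
apply: (cluster_eq _ hS
  (continuous_mulg (continuous_mulg (cc (c * b)) c1) (cc y))
  (continuous_mulg c1 (cc y)) clxy).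
by exists 0 => // n _ /=; rewrite -Dy BSl !mulgA.
Qed.

(** * Continuity of inversion in a semigroup that is algebraically a group *)

Section Inversion.
Variables (H : topologicalSemigroupType) (one : H) (inv : H -> H).
Hypotheses (hH : hausdorff_space H) (clH : pair_cluster H).
Hypotheses (lid : left_id one mul) (rid : right_id one mul).
Hypotheses (linv : left_inverse one inv mul) (rinv : right_inverse one inv mul).

Lemma nbhs_mul_sub (U : set H) : nbhs one U ->
  exists2 V, nbhs one V & forall x y, V x -> V y -> U (x * y).
Proof.
rewrite -{1}[one]lid => /(@mulg_continuous H (one, one))[[A B] /= [A1 B1] AB].
exists (A `&` B); first exact: filterI.
by move=> x y [Ax _] [_ By]; apply: (AB (x, y)).
Qed.

Lemma right_inverse_eq (x y : H) : x * y = one -> inv x = y.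
Proof. by move=> xy; rewrite -[LHS]rid -xy mulgA linv lid. Qed.

Lemma inverse_continuous_at_one (U : set H) :
  nbhs one U -> nbhs one (inv @^-1` U).
Proof.
move=> U1; apply: contrapT => nU.
(* The choice function [r] is total, so it takes an arbitrary value at sets that are not
   neighborhoods of [one]. *)
have /choice[r rP] (V : set H) : exists W, nbhs one V ->
    nbhs one W /\ forall x y, W x -> W y -> V (x * y).
  have [/nbhs_mul_sub[W W1 WV]|nV] := pselect (nbhs one V); last first.
    by exists setT.
  by exists W.
pose V n := iter n r U.
have V1 n : nbhs one (V n) by elim: n => //= n /rP[].
have VM n x y : V n.+1 x -> V n.+1 y -> V n (x * y).
  by have [_ +] := rP _ (V1 n); apply.
have VS n x : V n.+1 x -> V n x.
  by rewrite -{2}[x]rid => /VM; apply; exact: nbhs_singleton.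
have /choice[x xP] n : exists x, V n.+1 x /\ ~ U (inv x).
  apply: contrapT => nx; apply: nU; apply: filterS (V1 n.+1) => x Vx.
  by apply: contrapT => Ux; apply: nx; exists x.
pose y := fix y n := if n is m.+1 then y m * x m else one.
have yS n : inv (y n) = x n * inv (y n.+1).
  by apply: right_inverse_eq; rewrite mulgA rinv.
have xV n : inv (x n) = inv (y n.+1) * y n.
  by apply: right_inverse_eq; rewrite mulgA -yS linv.
(* The element is [x n * ... * x (n + k - 1)]: its first factor lies in [V n.+1], and by induction
   so does the product of the others. *)
have yV n k : V n (inv (y n) * y (n + k)).
  elim: k n => [|k IH] n; first by rewrite addn0 linv; exact: nbhs_singleton.
  by rewrite yS -mulgA addnS -addSn; apply: VM => //; case: (xP n).
have [l [l' cll]] := clH y (inv \o y).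
have ll' : l * l' = one.
  apply: (cluster_eq (f := fun z => z.1 * z.2) _ hH _ _ cll).
  - exact: mulg_continuous.
  - by move=> ?; exact: cvg_cst.
  - by exists 0 => // n _ /=; rewrite rinv.
have l'l : l' * l = one by rewrite -(right_inverse_eq ll') linv.
(* Index 2 leaves room for two products: [inv (y m) * l] and [l' * y n] in [V 2] give
   [inv (y m) * y n] in [V 1], and one more factor from [V 1] leads to [V 0], which is [U]. *)
pose O := [set z : H * H | V 2 (l' * z.1) /\ V 2 (z.2 * l)].
have nO : nbhs (l, l') O.
  exists ([set z | V 2 (l' * z)], [set z | V 2 (z * l)]) => //; split => /=.
  - by apply: continuous_lmul; rewrite l'l; exact: (V1 2).
  - by apply: continuous_rmul; rewrite l'l; exact: (V1 2).
have freq N : exists2 n, N <= n & O (y n, inv (y n)).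
  have /(_ O _ nO) := cll [set z | exists2 n, N <= n & (y n, inv (y n)) = z].
  case; first by exists N => // n /= Nn; exists n.
  by move=> _ [[n Nn <-] On]; exists n.
have [n _ [/= Ln _]] := freq 0; have [m nm [/= _ Rm]] := freq n.+1.
have [_] := xP n; apply; rewrite xV.
have -> : inv (y n.+1) * y n =
    (inv (y n.+1) * y m) * ((inv (y m) * l) * (l' * y n)).
  rewrite -!mulgA; congr (_ * _).
  by rewrite [l * _]mulgA ll' lid [RHS]mulgA rinv lid.
apply: (VM 0); last exact: VM.
have : V n.+1 (inv (y n.+1) * y m) by rewrite -(subnKC nm); exact: yV.
by move: (inv _ * _) => z; elim: n {Ln nm} => // n IH /VS.
Qed.

(** Translation moves continuity from [one] to [x], since [inv s = inv (inv x * s) * inv x]. *)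
Lemma inverse_continuous : continuous inv.
Proof.
move=> x U xU.
have invE s : inv (inv x * s) * inv x = inv s.
  by apply/esym/right_inverse_eq; rewrite -[s in s * _]lid -{1}(rinv x) -!mulgA
    [inv x * (s * _)]mulgA [_ * (inv _ * _)]mulgA rinv lid rinv.
have V1 : nbhs one (inv @^-1` [set s | U (s * inv x)]).
  by apply: inverse_continuous_at_one; apply: continuous_rmul; rewrite lid.
rewrite -(linv x) in V1.
have xV := @continuous_lmul H (inv x) x _ V1.
have -> : inv = fun s => inv (inv x * s) * inv x.
  by apply/funext => s; rewrite invE.
exact: xV.
Qed.

End Inversion.

(** * Subspaces and maps between products *)

Definition in_set_type (T : Type) (A : set T) (x : T) (Ax : A x) : set_type A :=
  exist _ x (mem_set Ax).

Lemma continuous_val (X : topologicalType) (A : set X) :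
  continuous (\val : set_type A -> X).
Proof. exact: initial_continuous. Qed.

Lemma continuous_to_set_type (X Y : topologicalType) (A : set Y)
    (f : X -> set_type A) :
  continuous (fun x => \val (f x)) -> continuous f.
Proof. by move=> cf; apply: continuous_comp_initial; exact: cf. Qed.

Lemma hausdorff_set_type (X : topologicalType) (A : set X) :
  hausdorff_space X -> hausdorff_space (set_type A).
Proof.
move=> hX; apply: hausdorff_separating => p q npq; exists X, \val.
by split=> //; [exact: continuous_val|move=> /val_inj].
Qed.

Lemma continuous_fst (X Y Z : topologicalType) (f : X -> Z) :
  continuous f -> continuous (fun z : X * Y => f z.1).
Proof.
move=> cf z; apply: (@continuous_comp _ _ _ fst f z); last exact: cf.
exact: cvg_fst.
Qed.

Lemma continuous_snd (X Y Z : topologicalType) (f : Y -> Z) :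
  continuous f -> continuous (fun z : X * Y => f z.2).
Proof.
move=> cf z; apply: (@continuous_comp _ _ _ snd f z); last exact: cf.
exact: cvg_snd.
Qed.

Lemma continuous_pair (X Y Z : topologicalType) (f : X -> Y) (g : X -> Z) :
  continuous f -> continuous g -> continuous (fun x => (f x, g x)).
Proof. by move=> cf cg x; apply: cvg_pair; [exact: cf|exact: cg]. Qed.

(** * The topological monoid [e S e] of an idempotent [e] *)

Section Corner.
Variables (S : topologicalSemigroupType) (e : S).
Hypothesis ee : e * e = e.

(** This is [e S e], presented as the fixed points of the retraction [s |-> e s e]. *)
Definition corner := [set h : S | e * h = h /\ h * e = h].

Definition corner_type : Type := set_type corner.

HB.instance Definition _ := Topological.copy corner_type (set_type corner).

Lemma corner_val_continuous : continuous (\val : corner_type -> S).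
Proof. exact: continuous_val. Qed.

Lemma corner_mul (x y : S) : corner x -> corner y -> corner (x * y).
Proof. by move=> [ex _] [_ ye]; split; rewrite ?mulgA ?ex -?mulgA ?ye. Qed.

Lemma corner_sandwich (x : S) : corner (e * x * e).
Proof. by split; rewrite ?mulgA ?ee// -mulgA ee. Qed.

Lemma corner_valP (x : corner_type) : corner (\val x).
Proof. exact: set_mem (valP x). Qed.

Definition to_corner (x : S) (cx : corner x) : corner_type :=
  in_set_type cx.

Definition corner_mulg (x y : corner_type) :=
  to_corner (corner_mul (corner_valP x) (corner_valP y)).

Lemma corner_mulA : associative corner_mulg.
Proof. by move=> x y z; apply: val_inj; rewrite /= mulgA. Qed.

HB.instance Definition _ := isSemigroup.Build corner_type corner_mulA.

Lemma corner_mul_continuous :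
  continuous (fun xy : corner_type * corner_type => xy.1 * xy.2).
Proof.
apply: continuous_to_set_type.
have c1 : continuous (fun z : corner_type * corner_type => \val z.1).
  exact: continuous_fst corner_val_continuous.
have c2 : continuous (fun z : corner_type * corner_type => \val z.2).
  exact: continuous_snd corner_val_continuous.
exact: continuous_mulg c1 c2.
Qed.

HB.instance Definition _ :=
  PreTopologicalSemigroup_isTopologicalSemigroup.Build corner_type
    corner_mul_continuous.

Definition retract (s : S) : corner_type := to_corner (corner_sandwich s).

Lemma retract_continuous : continuous retract.
Proof.
apply: continuous_to_set_type; apply: (continuous_mulg (f := mul e)).
  exact: continuous_lmul.
by move=> ?; exact: cvg_cst.
Qed.

Lemma retract_val (h : corner_type) : retract (\val h) = h.
Proof.
by have [eh he] := corner_valP h; apply: val_inj; rewrite /= eh he.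
Qed.

(** * The topological group [e S e] *)

Section Paragroup.
Hypotheses (hS : hausdorff_space S) (clS : pair_cluster S).
Hypothesis SaS : forall a s : S, exists u v, s = u * a * v.

Lemma corner_cluster : pair_cluster corner_type.
Proof.
move=> u v; have [x [y clxy]] := clS (\val \o u) (\val \o v).
exists (retract x), (retract y).
pose f (z : S * S) := (retract z.1, retract z.2).
have cf : continuous f.
  exact: continuous_pair (continuous_fst retract_continuous)
    (continuous_snd retract_continuous).
have -> : (fun n => (u n, v n)) = f \o (fun n => (\val (u n), \val (v n))).
  by apply/funext => n; rewrite /f/= !retract_val.
exact: cluster_fmap cf clxy.
Qed.

(** From [e = u h v] comes [(e u e) (h (e v e)) = e], and [right_inverse_left] allows the two
    factors to be exchanged. So [(e v e) (e u e)] is a right inverse of [h], and the same lemma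
    makes it two-sided. *)
Lemma corner_inverse (h : corner_type) :
  exists k : corner_type, \val h * \val k = e /\ \val k * \val h = e.
Proof.
have [eh he] := corner_valP h; have [u [v euv]] := SaS (\val h) e.
have cu := corner_sandwich u; have cv := corner_sandwich v.
have hvu : e * u * e * (\val h * (e * v * e)) = e.
  rewrite !mulgA -[_ * e * \val h]mulgA eh -[_ * \val h * e]mulgA he.
  by rewrite -[e * u * _]mulgA -[e * (_ * _) * v]mulgA -euv !ee.
have [[eu ue] [ev ve]] := (cu, cv).
have [[evu vue] [ehv hve]] := (corner_mul cv cu, corner_mul (corner_valP h) cv).
have {}hvu := right_inverse_left hS clS eu ue ehv hve hvu.
exists (to_corner (corner_mul cv cu)); split; first by rewrite /= mulgA.
by apply: right_inverse_left; rewrite //= mulgA.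
Qed.

Definition corner_one : corner_type := @to_corner e (conj ee ee).
Definition corner_inv (h : corner_type) := projT1 (cid (corner_inverse h)).

Lemma corner_mul1 : left_id corner_one mul.
Proof. by move=> h; apply: val_inj; case: (corner_valP h). Qed.

Lemma corner_mulg1 : right_id corner_one mul.
Proof. by move=> h; apply: val_inj; case: (corner_valP h). Qed.

Lemma corner_mulV : left_inverse corner_one corner_inv mul.
Proof.
by move=> h; apply: val_inj => /=; rewrite /corner_inv; case: cid => k [].
Qed.

Lemma corner_mulgV : right_inverse corner_one corner_inv mul.
Proof.
by move=> h; apply: val_inj => /=; rewrite /corner_inv; case: cid => k [].
Qed.

HB.instance Definition _ :=
  Semigroup_isMonoid.Build corner_type corner_mul1 corner_mulg1.
HB.instance Definition _ := hasInv.Build corner_type corner_inv.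
HB.instance Definition _ :=
  Monoid_isGroup.Build corner_type corner_mulV corner_mulgV.

Lemma corner_hausdorff : hausdorff_space corner_type.
Proof. exact: hausdorff_set_type. Qed.

Lemma corner_inv_continuous : continuous (fun h : corner_type => h^-1).
Proof.
exact: (@inverse_continuous corner_type corner_one corner_inv corner_hausdorff
  corner_cluster corner_mul1 corner_mulg1 corner_mulV corner_mulgV).
Qed.

HB.instance Definition _ :=
  TopologicalSemigroup_isTopologicalGroup.Build corner_type
    corner_inv_continuous.

(** * The coordinates of the Rees product *)

Definition left_factor := [set x : S | x * e = x /\ e * x = e].
(** In terms of Green's relations these are the idempotents R-related to [e], and [left_factor]
    consists of those L-related to [e]; for instance [y y = y e y = e y = y]. *)
Definition right_factor := [set y : S | e * y = y /\ y * e = e].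

Lemma sandwich_corner (y : set_type right_factor) (x : set_type left_factor) :
  corner (\val y * \val x).
Proof.
have [[ey _] [xe _]] := (set_mem (valP y), set_mem (valP x)).
by split; rewrite ?mulgA ?ey -?mulgA ?xe.
Qed.

Definition sandwich (yx : set_type right_factor * set_type left_factor) :
    corner_type := to_corner (sandwich_corner yx.1 yx.2).

Lemma sandwich_continuous : continuous sandwich.
Proof.
apply: continuous_to_set_type.
exact: continuous_mulg (continuous_fst (@continuous_val _ _))
  (continuous_snd (@continuous_val _ _)).
Qed.

Definition ginv (s : S) : S := \val (retract s)^-1.

Lemma ginv_continuous : continuous ginv.
Proof.
move=> s; apply: (@continuous_comp _ _ _ (fun s => (retract s)^-1) \val s).
  apply: (@continuous_comp _ _ _ retract (fun h : corner_type => h^-1) s).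
    exact: retract_continuous.
  exact: corner_inv_continuous.
exact: corner_val_continuous.
Qed.

Lemma ginv_corner (s : S) : e * ginv s = ginv s /\ ginv s * e = ginv s.
Proof. exact: corner_valP. Qed.

Lemma mul_ginv (s : S) : e * s * ginv s = e.
Proof.
have [eg ge] := ginv_corner s; rewrite -eg mulgA.
by have /(congr1 \val) := mulgV (retract s).
Qed.

Lemma ginv_mul (s : S) : ginv s * s * e = e.
Proof.
have [eg ge] := ginv_corner s; rewrite -ge -[_ * e * s]mulgA -mulgA.
by have /(congr1 \val) := mulVg (retract s).
Qed.

(** Write [s = a e b] and [g = ginv s]. Then [e s e = (e a e) (e b e)], so [(e b e) g (e a e) = e]
    in the group [e S e], and [s g s = a (e b e g e a e) b = a e b]. *)
Lemma ginvK (s : S) : s * ginv s * s = s.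
Proof.
have [a [b sab]] := SaS e s.
have rM : retract s = retract a * retract b.
  apply: val_inj; rewrite /= sab !mulgA; congr (_ * _ * _).
  by rewrite -[_ * e * e]mulgA ee.
have : retract b * (retract s)^-1 * retract a = 1.
  by rewrite rM invgM mulgA mulgV mul1g mulVg.
move=> /(congr1 \val) /= bga; have [eg ge] := ginv_corner s.
transitivity (a * (e * b * e * ginv s * (e * a * e)) * b).
  by rewrite {1 3}sab -{1}eg -{1}ge -!mulgA.
by rewrite bga -sab.
Qed.

Lemma left_factorP (s : S) : left_factor (s * ginv s).
Proof.
have [_ ge] := ginv_corner s.
by split; rewrite ?mulgA ?mul_ginv // -mulgA ge.
Qed.

Lemma right_factorP (s : S) : right_factor (ginv s * s).
Proof.
have [eg _] := ginv_corner s.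
by split; rewrite ?ginv_mul // mulgA eg.
Qed.

Definition to_rees (s : S) : rees_product (sandwich : _ -> corner_type) :=
  (in_set_type (left_factorP s), retract s, in_set_type (right_factorP s)).

Definition of_rees (z : rees_product (sandwich : _ -> corner_type)) : S :=
  \val z.1.1 * \val z.1.2 * \val z.2.

Lemma to_reesK : cancel to_rees of_rees.
Proof.
move=> s; rewrite /of_rees /= -!mulgA [ginv s * (e * _)]mulgA.
have [eg ge] := ginv_corner s.
by rewrite ge [e * _]mulgA eg !mulgA !ginvK.
Qed.

Lemma of_reesK : cancel of_rees to_rees.
Proof.
move=> [[x h] y].
have [[xe ex] [eh he]] := (set_mem (valP x), corner_valP h).
have [ey ye] := set_mem (valP y); rewrite /to_rees /of_rees /=.
set s := \val x * \val h * \val y.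
(* Since [e x = e] and [y e = e], the outer factors of [s] disappear in [e s e]; hence [ginv s] is
   the inverse of [h]. *)
have rs : retract s = h.
  by apply: val_inj; rewrite /= /s !mulgA ex -[_ * e]mulgA ye -mulgA he.
have [eg ge] := ginv_corner s.
have hg : \val h * ginv s = e.
  by rewrite /ginv rs; have /(congr1 \val) := mulgV h.
have gh : ginv s * \val h = e.
  by rewrite /ginv rs; have /(congr1 \val) := mulVg h.
congr (_, _, _) => //; apply: val_inj => /=.
  (* Writing [ginv s] as [e * ginv s] lets [y e = e] absorb [y], and [x h (ginv s) = x e = x]
     remains. *)
  by rewrite /s -eg mulgA -[_ * e]mulgA ye -mulgA eg -mulgA hg xe.
by rewrite /s -ge !mulgA -[_ * e * \val x]mulgA ex ge gh ey.
Qed.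

Lemma of_reesM : {morph of_rees : a b / a * b}.
Proof. by move=> [[x h] y] [[x' h'] y']; rewrite /of_rees /= !mulgA. Qed.

Lemma paragroup_of_idempotent : topological_paragroup S.
Proof.
exists (set_type left_factor), (set_type right_factor), corner_type, sandwich.
split; first exact: hausdorff_set_type.
split; first exact: hausdorff_set_type.
split; first exact: corner_hausdorff.
split; first exact: sandwich_continuous.
exists to_rees; split; [|split].
- move=> s t.
  (* Multiplicativity is inherited from the inverse map [of_rees], for which it is mere
     associativity. *)
  by rewrite -[RHS]of_reesK of_reesM !to_reesK.
- have cid : continuous (fun s : S => s) by move=> s; exact: cvg_id.
  apply: (continuous_pair (f := fun s => (to_rees s).1)).
    apply: (continuous_pair (f := fun s => (to_rees s).1.1)).
      apply: continuous_to_set_type.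
      exact: continuous_mulg cid ginv_continuous.
    exact: retract_continuous.
  apply: continuous_to_set_type.
  exact: continuous_mulg ginv_continuous cid.
- exists of_rees; split; first exact: to_reesK.
  split; first exact: of_reesK.
  have cL : continuous (\val : set_type left_factor -> S).
    exact: continuous_val.
  have cR : continuous (\val : set_type right_factor -> S).
    exact: continuous_val.
  exact: continuous_mulg (continuous_fst (continuous_mulg (continuous_fst cL)
    (continuous_snd corner_val_continuous))) (continuous_snd cR).
Qed.

End Paragroup.
End Corner.

(** * Simplicity and the conclusion *)

Lemma simple_mul_ideal (S : semigroupType) (a s : S) :
  simple_semigroup S -> exists u v, s = u * a * v.
Proof.
move=> simS; suff: [set x | exists u v, x = u * a * v] s by [].
rewrite (simS [set x | exists u v, x = u * a * v]) //; split.
  by exists (a * a * a), a, a.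
move=> t _ [u [v ->]]; split.
  by exists (t * u), v; rewrite !mulgA.
by exists u, (v * t); rewrite !mulgA.
Qed.

Theorem theorem9 (S : topologicalSemigroupType)
    (S_nonempty : [set: S] !=set0)
    (S_hausdorff : hausdorff_space S)
    (S_simple : simple_semigroup S)
    (S_dcc : doubly_countably_compact S)
    (SS_cc : countably_compact (S * S)%type) :
  topological_paragroup S.
Proof.
have [e ee] := idempotent_exists S_nonempty S_hausdorff S_dcc.
apply: (paragroup_of_idempotent ee) => // [u v|a s]; last first.
  exact: simple_mul_ideal.
have [[x y] xy] := countably_compact_cluster (fun n => (u n, v n))
  (hausdorff_prod S_hausdorff S_hausdorff) SS_cc.
by exists x, y.
Qed.
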